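(* Let $k$ be even and let $G=G_0(u)\diamond H(u)$ be a connected non-odd-bipartite $k$-uniform hypergraph, where $H$ is odd-bipartite. Then $\lambda_{\min}(G)\le \dfrac{d_{G_0}(u)}{\nu(H)}$.
   Context: A $k$-uniform hypergraph $G=(V(G),E(G))$ has every edge a $k$-subset of $V(G)$; $\nu(G)=|V(G)|$, $d_G(v)$ is the number of edges of $G$ containing $v$; connectedness via walks. For $x\in\mathbb{R}^{V(G)}$, $x^e=\prod_{v\in e}x_v$, $x_e^k=\sum_{v\in e}x_v^k$. The signless Laplacian tensor $\mathcal{Q}(G)=\mathcal{D}(G)+\mathcal{A}(G)$, with $\mathcal{D}(G)$ diagonal with entries $d(v)$ and $\mathcal{A}(G)$ having entry $1/(k-1)!$ at $(i_1,\dots,i_k)$ iff $\{v_{i_1},\dots,v_{i_k}\}\in E(G)$. $\lambda_{\min}(G)$ is the least H-eigenvalue of $\mathcal{Q}(G)$; for even $k$ it equals $\min\{\sum_{e\in E(G)}(x_e^k+kx^e):\sum_v|x_v|^k=1\}$. $G$ is odd-bipartite if some bipartition $\{V_1,V_2\}$ of $V(G)$ has every edge meeting $V_1$ in an odd number of vertices; otherwise non-odd-bipartite. The coalescence $G_0(u)\diamond H(u)$ is obtained from vertex-disjoint $G_0,H$ by identifying a vertex of $G_0$ with a vertex of $H$ into the new vertex $u$. *)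

(* Defs.v *)
From HB Require Import structures.
From mathcomp Require Import all_boot all_order all_algebra.
From mathcomp Require Import reals.

Set Implicit Arguments.
Unset Strict Implicit.
Unset Printing Implicit Defensive.

Import Order.TTheory GRing.Theory Num.Theory.
Local Open Scope ring_scope.

Record hypergraph := Hypergraph {
  vertex : finType;
  edges : {set {set vertex}}
}.

Definition uniform (k : nat) (G : hypergraph) : Prop :=
  forall e : {set vertex G}, e \in edges G -> #|e| = k.

Definition nu (G : hypergraph) : nat := #|{: vertex G}|.

Definition deg (G : hypergraph) (v : vertex G) : nat :=
  #|[set e in edges G | v \in e]|.

Definition adjacent (G : hypergraph) : rel (vertex G) :=
  fun v w => [exists e in edges G, [set v; w] \subset e].

(* [connect] is the existence of a vertex sequence v0, ..., vl in which any
   two consecutive vertices lie in a common edge, i.e. of a walk. *)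
Definition connected_hypergraph (G : hypergraph) : Prop :=
  forall v w : vertex G, connect (@adjacent G) v w.

(* The bipartition is {V1, ~: V1}.  Empty parts are allowed, which only matters
   for edgeless hypergraphs when the uniformity is even: the one-vertex
   hypergraph counts as odd-bipartite. *)
Definition odd_bipartite (G : hypergraph) : Prop :=
  exists V1 : {set vertex G},
    forall e : {set vertex G}, e \in edges G -> odd #|e :&: V1|.

Section Coalescence.
Variables (G H : hypergraph) (u : vertex G) (w : vertex H).

(* The vertices of the coalescence are those of G together with those of H
   other than w; the vertex [inl u] is the identified one. *)
Definition coal_vertex : finType := (vertex G + {v : vertex H | v != w})%type.

Definition coal_inl (v : vertex G) : coal_vertex := inl v.

Definition coal_inr (v : vertex H) : coal_vertex :=
  if insub v is Some v' then inr v' else inl u.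

Definition coalescence : hypergraph :=
  @Hypergraph coal_vertex
    ([set coal_inl @: (e : {set vertex G}) | e in edges G] :|:
     [set coal_inr @: (e : {set vertex H}) | e in edges H]).

End Coalescence.

Section Tensors.
Variables (R : realType) (k : nat) (V : finType).

(* Real tensors of order k and dimension #|V|, with indices in V. *)
Definition tensor := k.-tuple V -> R.

(* (T x^{k-1})_i = \sum_(i_2, ..., i_k) t_(i i_2 ... i_k) x_(i_2) ... x_(i_k):
   the sum is over index tuples whose first component is i. *)
Definition tensor_app (T : tensor) (x : {ffun V -> R}) (i : V) : R :=
  \sum_(s : k.-tuple V | ohead s == Some i) T s * \prod_(j <- behead s) x j.

Definition H_eigenvalue (T : tensor) (lam : R) : Prop :=
  exists2 x : {ffun V -> R}, x != 0 &
    forall i : V, tensor_app T x i = lam * x i ^+ k.-1.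

Definition least_H_eigenvalue (T : tensor) (lam : R) : Prop :=
  H_eigenvalue T lam /\ forall mu : R, H_eigenvalue T mu -> lam <= mu.

End Tensors.

Section SignlessLaplacian.
Variables (R : realType) (k : nat) (G : hypergraph).

Definition degree_tensor : tensor R k (vertex G) := fun s =>
  if tval s is v :: s' then
    if all (pred1 v) s' then (deg v)%:R else 0
  else 0.

Definition adjacency_tensor : tensor R k (vertex G) := fun s =>
  if [set v in s] \in edges G then ((k.-1)`!)%:R^-1 else 0.

Definition signless_laplacian : tensor R k (vertex G) := fun s =>
  degree_tensor s + adjacency_tensor s.

Definition is_lambda_min (lam : R) : Prop :=
  least_H_eigenvalue signless_laplacian lam.

End SignlessLaplacian.

(* Main.v *)
Require Import Defs.
From HB Require Import structures.
From mathcomp Require Import classical_sets topology normedtype derive realfun.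
From mathcomp Require Import all_boot all_order all_algebra.
From mathcomp Require Import reals ring.

(* For even k the form x |-> \sum_e (x_e^k + k x^e) divided by \sum_v x_v^k
   attains its minimum lam over nonzero x by compactness.  The first variation in
   each coordinate shows that a minimiser is an H-eigenvector for lam, and
   contracting the eigenvalue equation with x shows that every H-eigenvalue is a
   value of the quotient; hence lam is the least H-eigenvalue.  It is at most the
   quotient of the vector equal to +1 or -1 on H according to its odd bipartition
   and to 0 elsewhere: each edge of H then contributes 0, each edge of G_0 at u
   contributes 1, the other edges of G_0 contribute 0, and the power sum is nu(H). *)

Set Implicit Arguments.
Unset Strict Implicit.
Unset Printing Implicit Defensive.

Import Order.TTheory GRing.Theory Num.Theory.
Import numFieldNormedType.Exports.
Local Open Scope classical_set_scope.
Local Open Scope ring_scope.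


(** * Minima of polynomials and of homogeneous quotients *)

Lemma deriv_eq0_at_min (R : realType) (p : {poly R}) (c : R) :
  (forall t, p.[c] <= p.[t]) -> p^`().[c] = 0.
Proof.
move=> pmin; have cc : c \in `]c - 1, c + 1[ by rewrite in_itv /= ltrBlDr ltrDl ltr01.
have c0 : c - 1 <= c + 1 by rewrite lerD2l (le_trans (lerN10 R)) ?ler01.
have dp t : t \in `]c - 1, c + 1[ -> derivable (horner p) t 1.
  by move=> _; exact: derivable_horner.
have d0 := derive1_at_min c0 dp cc (fun t _ => pmin t).
have d1 := is_derive_poly p c.
by rewrite -(@derive_val _ _ _ _ _ _ _ d1) (@derive_val _ _ _ _ _ _ _ d0).
Qed.

(* The ratio has degree 0, so a minimum on the compact sup-norm sphere is a
   global one. *)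
Lemma homogeneous_ratio_min (R : realType) (n k : nat) (f g : 'rV[R]_n -> R) :
  continuous f -> continuous g ->
  (forall a r, f (a *: r) = a ^+ k * f r) ->
  (forall a r, g (a *: r) = a ^+ k * g r) ->
  (forall r, r != 0 -> 0 < g r) -> (exists r : 'rV[R]_n, r != 0) ->
  exists2 r, r != 0 & forall s, s != 0 -> f r / g r <= f s / g s.
Proof.
move=> cf cg fZ gZ g_gt0 [r0 r0_neq0].
pose A : set 'rV[R]_n := [set r | `|r| = 1].
have nonzero r : A r -> r != 0.
  by rewrite /A /= => r1; rewrite -normr_eq0 r1 oner_eq0.
have scaleA r : r != 0 -> A (`|r|^-1 *: r).
  move=> rN0; rewrite /A /= normrZ ger0_norm ?invr_ge0 // mulVf //.
  by rewrite normr_eq0.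
have cptA : compact A.
  apply: bounded_closed_compact.
    exists 1; split; first exact: num_real.
    by move=> M M1 r; rewrite /A /= => ->; exact: ltW.
  have -> : A = ((fun r => `|r|) @^-1` [set x | x = 1%R]) by [].
  apply: preimage_closed; last exact: closed_eq.
  by move=> r _; exact: norm_continuous.
have cfg r : A r -> {for r, continuous (fun s => f s / g s)}.
  move=> Ar; apply: continuousM; first exact: cf.
  by apply: continuousV; [rewrite gt_eqF ?g_gt0 ?nonzero | exact: cg].
have {}cfg : {within A, continuous (fun r => f r / g r)}.
  apply: continuous_in_subspaceT => r /set_mem Ar; exact: cfg.
have [|r rA rmin] := EVT_min_rV _ cptA cfg.
  by exists (`|r0|^-1 *: r0); exact: scaleA.
move/set_mem: rA => rA; exists r => [|s sN0]; first exact: nonzero.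
(* Rescaling [s] to norm 1 multiplies [f] and [g] by the same factor, which cancels in the
   quotient. *)
have /rmin : `|s|^-1 *: s \in A by apply/mem_set; exact: scaleA.
rewrite fZ gZ invfM mulrACA divff ?mul1r //.
by rewrite expf_neq0 // invr_eq0 normr_eq0.
Qed.

(** * Index tuples of tensors *)

Lemma tensor_app_cons (R : realType) (n : nat) (V : finType) (T : tensor R n.+1 V)
    (x : {ffun V -> R}) (i : V) :
  tensor_app T x i =
  \sum_(t : n.-tuple V) T [tuple of i :: t] * \prod_(j <- t) x j.
Proof.
rewrite /tensor_app (reindex_onto (fun t : n.-tuple V => [tuple of i :: t])
  (fun s => [tuple of behead s])) /=; last first.
  case=> [[|j s] //= szs] /eqP [->]; exact/val_inj.
apply: eq_big => [t|t _] //.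
by rewrite eqxx /=; apply/eqP/val_inj.
Qed.

Lemma prod_uniq_tuple (R : comNzRingType) (n : nat) (V : finType)
    (x : V -> R) (A : {set V}) (t : n.-tuple V) :
  uniq t -> A =i t -> \prod_(v <- t) x v = \prod_(v in A) x v.
Proof.
by move=> ut At; rewrite big_uniq //=; apply: eq_bigl => v; rewrite At.
Qed.

(** Counting decides it: [e :\ i] has [n] elements, so [n] entries exhaust it only without
    repetition. The index tuples attached to an edge thus become the orderings of [e :\ i]. *)
Lemma uniq_tuple_cover (n : nat) (V : finType) (i : V) (e : {set V})
    (t : n.-tuple V) : i \in e -> #|e| = n.+1 ->
  ([set v in i :: t] == e) = all [in e :\ i] t && uniq t.
Proof.
move=> ie ce; have ce1 : #|e :\ i| = n.
  by apply/eqP; rewrite -eqSS -ce (cardsD1 i e) ie.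
apply/eqP/idP => [te|/andP[/allP te ut]]; last first.
  have te1 : [set v in t] = e :\ i.
    apply/eqP; rewrite eqEcard ce1 cardsE (card_uniqP ut) size_tuple leqnn andbT.
    by apply/fintype.subsetP => v; rewrite inE => /te.
  by rewrite -(setD1K ie) -te1; apply/setP => v; rewrite !inE.
have uit : uniq (i :: t).
  by apply/card_uniqP; rewrite -cardsE te ce /= size_tuple.
move: (uit) => /= /andP[it ->]; rewrite andbT; apply/allP => v vt.
rewrite !inE -te inE in_cons vt orbT andbT.
by apply: contraNneq it => <-.
Qed.

(** * The form of the signless Laplacian tensor *)

Section LaplacianForm.
Variables (R : realType) (k : nat) (G : hypergraph).
Implicit Types (x y : vertex G -> R) (i : vertex G) (e : {set vertex G}).

Definition edge_sum x e : R :=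
  \sum_(v in e) x v ^+ k + (\prod_(v in e) x v) *+ k.

Definition laplacian_form x : R := \sum_(e in edges G) edge_sum x e.

Definition power_sum x : R := \sum_v x v ^+ k.

(* The off-diagonal part of (Q x^{k-1})_i. *)
Definition link_sum x i : R :=
  \sum_(e in edges G | i \in e) \prod_(v in e :\ i) x v.

(** Double counting of incidences: [x v ^+ k] occurs once for every edge through [v]. *)
Lemma laplacian_formE x :
  laplacian_form x = \sum_v (deg v)%:R * x v ^+ k
                     + (\sum_(e in edges G) \prod_(v in e) x v) *+ k.
Proof.
rewrite /laplacian_form big_split sumrMnl; congr (_ + _) => /=.
rewrite (exchange_big_dep predT) //=; apply: eq_bigr => v _.
by rewrite mulr_natl -sumr_const; apply: eq_bigl => e; rewrite inE.
Qed.

(** The weight 1/(k-1)! cancels because each edge through [i] arises from exactly (k-1)! tuples, the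
    orderings of its other vertices. *)
Lemma tensor_app_signless_laplacian (x : {ffun vertex G -> R}) i :
  (0 < k)%N -> uniform k G ->
  tensor_app (@signless_laplacian R k G) x i
  = (deg i)%:R * x i ^+ k.-1 + link_sum x i.
Proof.
rewrite /signless_laplacian /adjacency_tensor.
case: k => // n _ unif; rewrite tensor_app_cons /=.
under eq_bigr do rewrite mulrDl; rewrite big_split /=; congr (_ + _).
  (* Among tuples headed by [i], the diagonal tensor is supported on the constant one. *)
  rewrite (bigD1 (nseq_tuple n i)) //= [X in _ + X]big1 ?addr0 => [|t tN].
    by rewrite /degree_tensor /= all_pred1_nseq big_nseq iter_mulr_1.
  rewrite /degree_tensor /=; case: ifP => [/all_pred1P tE|]; last by rewrite mul0r.
  by case/eqP: tN; apply/val_inj; rewrite /= tE size_tuple.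
under eq_bigr do rewrite (fun_if (fun c => c * _)) mul0r.
rewrite -big_mkcond /=.
(* Tuples are grouped by the edge that they form together with [i]. *)
rewrite (partition_big (fun t : n.-tuple _ => [set v in i :: t])
  (fun e => (e \in edges G) && (i \in e))) /=; last first.
  by move=> t ->; rewrite !inE eqxx.
apply: eq_bigr => e /andP[eG ie].
have ce1 : #|e :\ i| = n.
  by apply/eqP; rewrite -eqSS -(unif e) // (cardsD1 i e) ie.
have fact_neq0 : n`!%:R != 0 :> R by rewrite pnatr_eq0 -lt0n fact_gt0.
transitivity (\sum_(t in [set t : n.-tuple (vertex G) | all [in e :\ i] t & uniq t])
    n`!%:R^-1 * \prod_(v in e :\ i) x v).
  apply: eq_big => [t|t /andP[_]].
    rewrite inE -uniq_tuple_cover ?unif //.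
    by apply: andb_idl => /eqP ->.
  move=> te; congr (_ * _); move: (te); rewrite uniq_tuple_cover ?unif //.
  case/andP=> /allP tA ut; apply: prod_uniq_tuple => //.
  apply/fsym/subset_cardP; last by apply/fintype.subsetP=> v /tA.
  by rewrite (card_uniqP ut) size_tuple.
rewrite sumr_const card_uniq_tuples ce1 ffactnn -[LHS]mulr_natl.
by rewrite mulrA divff // mul1r.
Qed.

(** Multiplying by [x i] restores the factor missing from each link product; an edge is met once
    from each of its [k] vertices, whence the coefficient [k] of its product. *)
Lemma euler_laplacian_form (x : {ffun vertex G -> R}) : (0 < k)%N -> uniform k G ->
  \sum_i x i * tensor_app (@signless_laplacian R k G) x i = laplacian_form x.
Proof.
move=> k_gt0 unif; rewrite laplacian_formE.
under eq_bigr do rewrite tensor_app_signless_laplacian // mulrDr mulrCA -exprS prednK //.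
rewrite big_split /=; congr (_ + _).
under eq_bigr do rewrite mulr_sumr.
rewrite (exchange_big_dep [in edges G]) /=; last by move=> ? ? _ /andP[].
rewrite -sumrMnl; apply: eq_bigr => e eG.
rewrite -[in RHS](unif e eG) -sumr_const; apply: eq_big => [i|i /andP[_ ie]].
  by rewrite eG.
by rewrite [RHS](big_setD1 i).
Qed.


(** * Homogeneity, continuity and existence of a minimiser *)

Lemma edge_sumZ a x e : uniform k G -> e \in edges G ->
  edge_sum (fun v => a * x v) e = a ^+ k * edge_sum x e.
Proof.
move=> unif eG; rewrite /edge_sum mulrDr mulr_sumr mulrnAr big_split /=.
by rewrite prodr_const (unif e eG); under eq_bigr do rewrite exprMn.
Qed.

Lemma laplacian_formZ a x : uniform k G ->
  laplacian_form (fun v => a * x v) = a ^+ k * laplacian_form x.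
Proof.
move=> unif; rewrite /laplacian_form mulr_sumr.
by apply: eq_bigr => e eG; exact: edge_sumZ.
Qed.

Lemma power_sumZ a x : power_sum (fun v => a * x v) = a ^+ k * power_sum x.
Proof. by rewrite /power_sum mulr_sumr; apply: eq_bigr => v; rewrite exprMn. Qed.

Lemma power_sum_gt0 x v : ~~ odd k -> x v != 0 -> 0 < power_sum x.
Proof.
move=> k_even xv; rewrite /power_sum (bigD1 v) //= ltr_wpDr //.
  by apply: sumr_ge0 => w _; exact: exprn_even_ge0.
by rewrite exprn_even_gt0 // xv orbT.
Qed.

Lemma eq_laplacian_form x y : x =1 y -> laplacian_form x = laplacian_form y.
Proof.
move=> xy; apply: eq_bigr => e _; rewrite /edge_sum.
by congr (_ + _ *+ _); apply: eq_bigr => v _; rewrite xy.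
Qed.

Lemma eq_power_sum x y : x =1 y -> power_sum x = power_sum y.
Proof. by move=> xy; apply: eq_bigr => v _; rewrite xy. Qed.

(** Row vectors carry the norm in which the compactness argument takes place. *)
Definition of_row (r : 'rV[R]_#|vertex G|) : vertex G -> R :=
  fun v => r ord0 (enum_rank v).

Lemma of_row_continuous v : continuous (fun r => of_row r v).
Proof. exact: coord_continuous. Qed.

Lemma of_row_expr_continuous v : continuous (fun r => of_row r v ^+ k).
Proof.
move=> r; apply: (@continuous_comp _ _ _ (fun r => of_row r v) (fun a => a ^+ k)).
  exact: of_row_continuous.
exact: exprn_continuous.
Qed.

Lemma power_sum_of_row_continuous : continuous (fun r => power_sum (of_row r)).
Proof.
apply: continuous_big => [|v _]; first exact: add_continuous.
exact: of_row_expr_continuous.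
Qed.

Lemma laplacian_form_of_row_continuous :
  continuous (fun r => laplacian_form (of_row r)).
Proof.
apply: continuous_big => [|e _]; first exact: add_continuous.
have sum_cont : continuous (fun r => \sum_(v in e) of_row r v ^+ k).
  apply: continuous_big => [|v _]; first exact: add_continuous.
  exact: of_row_expr_continuous.
have prod_cont : continuous (fun r => \prod_(v in e) of_row r v).
  apply: continuous_big => [|v _]; first exact: mul_continuous.
  exact: of_row_continuous.
have edge_cont r : {for r, continuous (fun r => edge_sum (of_row r) e)}.
  apply: continuousD; first exact: sum_cont.
  exact: (continuous_comp (prod_cont r) (@natmul_continuous _ _ k _)).
by move=> r; exact: edge_cont.
Qed.

(** The bound is stated without division, so that it covers [y = 0] and applies to every vector. *)
Lemma rayleigh_minimizer : (0 < k)%N -> ~~ odd k -> uniform k G ->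
  (0 < nu G)%N -> exists lam, exists2 x : {ffun vertex G -> R}, x != 0 &
  laplacian_form x = lam * power_sum x /\
  forall y, lam * power_sum y <= laplacian_form y.
Proof.
move=> k_gt0 k_even unif nuG.
have of_rowZ a r : of_row (a *: r) =1 (fun v => a * of_row r v).
  by move=> v; rewrite /of_row mxE.
have power_gt0 r : r != 0 -> 0 < power_sum (of_row r).
  case/rV0Pn => j rj; apply: (@power_sum_gt0 _ (enum_val j)) => //.
  by rewrite /of_row enum_valK.
have row_neq0 : exists r : 'rV[R]_#|vertex G|, r != 0.
  exists (const_mx 1); apply/rV0Pn; exists (Ordinal nuG).
  by rewrite mxE oner_eq0.
have [||r rN0 rmin] := @homogeneous_ratio_min R _ k _ _
  laplacian_form_of_row_continuous power_sum_of_row_continuous _ _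
  power_gt0 row_neq0.
- by move=> a r; rewrite (eq_laplacian_form (of_rowZ a r)) laplacian_formZ.
- by move=> a r; rewrite (eq_power_sum (of_rowZ a r)) power_sumZ.
set x := [ffun v => of_row r v].
have xr : x =1 of_row r by move=> v; rewrite ffunE.
exists (laplacian_form (of_row r) / power_sum (of_row r)), x.
  have /rV0Pn[j rj] := rN0.
  apply: contraNneq rj => x0.
  by move: (xr (enum_val j)); rewrite x0 ffunE /of_row enum_valK => <-.
split; first by rewrite (eq_laplacian_form xr) (eq_power_sum xr) divfK ?gt_eqF ?power_gt0.
move=> y; pose s : 'rV[R]_#|vertex G| := \row_j y (enum_val j).
have ys : y =1 of_row s by move=> v; rewrite /of_row mxE enum_rankK.
rewrite (eq_laplacian_form ys) (eq_power_sum ys).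
have [s0|sN0] := eqVneq s 0; last by rewrite -ler_pdivlMr ?power_gt0 ?rmin.
(* The zero vector is 0 times itself, so homogeneity with [k > 0] makes both sides vanish. *)
have s00 : of_row s =1 (fun v => 0 * of_row s v).
  by move=> v; rewrite s0 /of_row mxE mul0r.
rewrite (eq_laplacian_form s00) (eq_power_sum s00).
by rewrite laplacian_formZ // power_sumZ expr0n gtn_eqF // !mul0r mulr0.
Qed.

(** * First variation at a minimiser and the bound on H-eigenvalues *)

Definition update x i (s : R) : vertex G -> R := fun v => if v == i then s else x v.

Lemma power_sum_update x i s :
  power_sum (update x i s) = s ^+ k + \sum_(v | v != i) x v ^+ k.
Proof.
rewrite /power_sum (bigD1 i) //= /update eqxx; congr (_ + _).
by apply: eq_bigr => v /negPf ->.
Qed.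

(** Splitting the edges by whether they contain [i] isolates the dependence on [s]; the last
    parenthesis is constant in [s]. *)
Lemma laplacian_form_update x i s :
  laplacian_form (update x i s) =
  (deg i)%:R * s ^+ k + (s * link_sum x i) *+ k
  + (\sum_(v | v != i) (deg v)%:R * x v ^+ k
     + (\sum_(e in edges G | i \notin e) \prod_(v in e) x v) *+ k).
Proof.
have upd_out e : i \notin e -> \prod_(v in e) update x i s v = \prod_(v in e) x v.
  move=> ie; apply: eq_bigr => v ve; rewrite /update.
  by case: eqP ie => // <-; rewrite ve.
rewrite laplacian_formE (bigD1 i) //= {1}/update eqxx.
rewrite [X in _ + X *+ k](bigID (fun e => i \in e)) /= mulrnDl.
rewrite addrACA; congr (_ + _ *+ _ + (_ + _ *+ _)).
- rewrite mulr_sumr; apply: eq_bigr => e /andP[_ ie].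
  rewrite (big_setD1 i) //= upd_out ?setD11 //; congr (_ * _).
  by rewrite /update eqxx.
- by apply: eq_bigr => v /negPf vi; rewrite /update vi.
by apply: eq_bigr => e /andP[_ ie]; exact: upd_out.
Qed.

Lemma minimizer_H_eigenvector (x : {ffun vertex G -> R}) lam :
  (0 < k)%N -> uniform k G ->
  laplacian_form x = lam * power_sum x ->
  (forall y, lam * power_sum y <= laplacian_form y) ->
  forall i, tensor_app (@signless_laplacian R k G) x i = lam * x i ^+ k.-1.
Proof.
move=> k_gt0 unif x_eq x_min i; rewrite tensor_app_signless_laplacian //.
pose c := \sum_(v | v != i) (deg v)%:R * x v ^+ k
          + (\sum_(e in edges G | i \notin e) \prod_(v in e) x v) *+ k
          - lam * \sum_(v | v != i) x v ^+ k.
(* As a function of the i-th coordinate alone, laplacian_form - lam * power_sum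
   is this polynomial, which is minimal at x i. *)
pose p : {poly R} := ((deg i)%:R - lam) *: 'X^k + (link_sum x i *+ k) *: 'X + c%:P.
have pE s : p.[s] = laplacian_form (update x i s) - lam * power_sum (update x i s).
  rewrite laplacian_form_update power_sum_update /p 2!hornerD !hornerZ hornerXn hornerX hornerC /c.
  by ring.
have upd_id : update x i (x i) =1 x by move=> v; rewrite /update; case: eqP => [->|].
have /deriv_eq0_at_min : forall t, p.[x i] <= p.[t].
  move=> t; rewrite !pE (eq_laplacian_form upd_id) (eq_power_sum upd_id) x_eq subrr.
  by rewrite subr_ge0.
rewrite /p !derivE !(hornerE, hornerMn, hornerXn) => dp.
(* The vanishing derivative is [k] times the residual of the eigenvalue equation at [i]. *)
have : ((deg i)%:R * x i ^+ k.-1 + link_sum x i - lam * x i ^+ k.-1) *+ k = 0.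
  by rewrite -[RHS]dp; ring.
by move/eqP; rewrite mulrn_eq0 eqn0Ngt k_gt0 /= subr_eq0 => /eqP.
Qed.

(** Contracting with the eigenvector [x] gives [laplacian_form x = mu * power_sum x], and evenness
    of [k] makes this power sum positive, so it can be cancelled. *)
Lemma H_eigenvalue_ge lam mu : (0 < k)%N -> ~~ odd k -> uniform k G ->
  (forall y, lam * power_sum y <= laplacian_form y) ->
  H_eigenvalue (@signless_laplacian R k G) mu -> lam <= mu.
Proof.
move=> k_gt0 k_even unif lam_min [x xN0 x_eig].
have [v xv] : exists v, x v != 0.
  apply/existsP; apply: contraR xN0; rewrite negb_exists => /forallP x0.
  by apply/eqP/ffunP => v; rewrite ffunE; apply/eqP; rewrite -[_ == _]negbK x0.
rewrite -(ler_pM2r (power_sum_gt0 k_even xv)) (le_trans (lam_min x)) //.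
rewrite -euler_laplacian_form // /power_sum mulr_sumr; apply: ler_sum => i _.
by rewrite x_eig mulrCA -exprS prednK.
Qed.

End LaplacianForm.

(** * The test vector on the coalescence *)

Section CoalescenceBound.
Variables (R : realType) (k : nat) (G H : hypergraph) (u : vertex G) (w : vertex H).
Implicit Types (e : {set vertex G}) (f : {set vertex H}) (A : {set vertex H}).

Lemma coal_inl_inj : injective (@coal_inl G H w).
Proof. by move=> v v' []. Qed.

(** Only [w] lands in the left summand; elsewhere [coal_inr] is the right injection. *)
Lemma coal_inr_inj : injective (@coal_inr G H u w).
Proof.
move=> v v'; rewrite /coal_inr.
case: insubP => [a _ <-|/negPn/eqP ->]; case: insubP => [b _ <-|/negPn/eqP ->] //.
by case=> ->.
Qed.

Definition side_sign A (v : vertex H) : R := if v \in A then -1 else 1.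

(* On the odd-bipartite branch every edge has x^e = -1 and contributes
   k - k = 0; off the branch the vector vanishes. *)
Definition test_vector A (v : @coal_vertex G H w) : R :=
  match v with
  | inl v' => if v' == u then side_sign A w else 0
  | inr v' => side_sign A (val v')
  end.

(** At [w], which [coal_inr] sends to [inl u], this relies on the value [side_sign A w] chosen
    there. *)
Lemma test_vector_inr A v : test_vector A (@coal_inr G H u w v) = side_sign A v.
Proof.
rewrite /coal_inr; case: insubP => [a _ <-|/negPn/eqP ->] //=.
by rewrite eqxx.
Qed.

Lemma side_sign_even A v : ~~ odd k -> side_sign A v ^+ k = 1.
Proof.
by move=> k_even; rewrite /side_sign; case: ifP; rewrite ?expr1n // -signr_odd (negPf k_even).
Qed.

Lemma prod_side_sign A f :
  \prod_(v in f) side_sign A v = (-1) ^+ odd #|f :&: A|.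
Proof.
rewrite /side_sign -big_mkcondr /= signr_odd -prodr_const.
by apply: eq_bigl => v; rewrite inE.
Qed.

Lemma edge_sum_test_inr A f : ~~ odd k -> #|f| = k -> odd #|f :&: A| ->
  @edge_sum R k (coalescence u w) (test_vector A) (@coal_inr G H u w @: f) = 0.
Proof.
move=> k_even cf oddf; rewrite /edge_sum !big_imset /=; try by move=> ? ? _ _ /coal_inr_inj.
under eq_bigr do rewrite test_vector_inr side_sign_even //.
under [X in _ + X *+ _]eq_bigr do rewrite test_vector_inr.
by rewrite prod_side_sign oddf sumr_const cf expr1 mulNrn subrr.
Qed.

(** The product vanishes and the power sum keeps only the contribution of [u]. *)
Lemma edge_sum_test_inl A e : ~~ odd k -> (0 < k)%N -> #|e| = k ->
  @edge_sum R k (coalescence u w) (test_vector A) (@coal_inl G H w @: e)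
  = (u \in e)%:R.
Proof.
move=> k_even k_gt0 ce.
(* An even positive [k] is at least 2, so [e] has a vertex besides [u], where the test vector is
   0. *)
have [v ve vu] : exists2 v, v \in e & v != u.
  have /card_gt0P[v] : (0 < #|e :\ u|)%N.
    rewrite -(ltn_add2l (u \in e)) -cardsD1 ce addn0.
    by case: k k_even k_gt0 => [|[|n]] //; case: (u \in e).
  by rewrite !inE => /andP[vu ve]; exists v.
rewrite /edge_sum !big_imset /=; try by move=> ? ? _ _ /coal_inl_inj.
rewrite [X in _ + X *+ _](bigD1 v) //= (negPf vu) mul0r mul0rn addr0.
under eq_bigr do rewrite (fun_if (fun a => a ^+ k)) side_sign_even // expr0n gtn_eqF //.
rewrite -big_mkcondr /= sumr_const; congr _%:R.
case: (boolP (u \in e)) => ue.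
  apply: (@eq_card1 _ u) => a; rewrite !inE unfold_in /=.
  by case: (a =P u) => [->|]; rewrite ?ue ?andbF.
by apply: eq_card0 => a; rewrite unfold_in /=; case: eqP => [->|]; rewrite ?(negPf ue) ?andbF.
Qed.

Lemma laplacian_form_test A : ~~ odd k -> (0 < k)%N ->
  uniform k G -> uniform k H ->
  (forall f, f \in edges H -> odd #|f :&: A|) ->
  laplacian_form k (G := coalescence u w) (test_vector A) <= (deg u)%:R :> R.
Proof.
move=> k_even k_gt0 unifG unifH bip; rewrite /laplacian_form.
(* Splitting by membership in the image of [edges G] avoids proving the two images disjoint: edges
   outside it come from [H] and contribute 0. *)
rewrite (bigID [in [set @coal_inl G H w @: e | e : {set vertex G} in edges G]]) /=.
rewrite [X in _ + X]big1 ?addr0 => [|e /andP[]]; last first.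
  case/setUP => [->//|/imsetP[f fH ->]] _.
  by rewrite (edge_sum_test_inr k_even (unifH f fH) (bip f fH)).
rewrite (eq_bigl [in [set @coal_inl G H w @: e | e : {set vertex G} in edges G]]);
  last by move=> e; apply: andb_idl => einl; apply/setUP; left.
rewrite big_imset /=; last by move=> ? ? _ _; exact/imset_inj/coal_inl_inj.
under eq_bigr => e eG do rewrite edge_sum_test_inl ?unifG //.
rewrite -natr_sum ler_nat /deg -sum1_card big_mkcond [leqRHS]big_mkcond /=.
by apply: leq_sum => e _; rewrite inE; case: (e \in _); case: (u \in e).
Qed.

(** The support is the copy of [H]: [inl u] stands for [w], and the right summand for the other
    vertices. *)
Lemma power_sum_test A : ~~ odd k -> (0 < k)%N ->
  power_sum k (G := coalescence u w) (test_vector A) = (nu H)%:R :> R.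
Proof.
move=> k_even k_gt0; rewrite /power_sum big_sumType /=.
rewrite (bigD1 u) //= eqxx side_sign_even // big1 ?addr0; last first.
  by move=> v /negPf ->; rewrite expr0n gtn_eqF.
under eq_bigr do rewrite side_sign_even //.
rewrite sumr_const card_sig nat1r /nu [in RHS](cardD1 w) add1n; congr (_.+1)%:R.
by apply: eq_card => v; rewrite !inE andbT.
Qed.

(** Uniformity is given for the coalescence; injective embeddings preserve edge sizes, so it passes
    to both branches. *)
Lemma uniform_coal_inl : uniform k (coalescence u w) -> uniform k G.
Proof.
move=> unif e eG; rewrite -(card_imset e coal_inl_inj); apply: unif.
by apply/setUP; left; exact: imset_f.
Qed.

Lemma uniform_coal_inr : uniform k (coalescence u w) -> uniform k H.
Proof.
move=> unif f fH; rewrite -(card_imset f coal_inr_inj); apply: unif.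
by apply/setUP; right; exact: imset_f.
Qed.

End CoalescenceBound.

Theorem theorem5p3 (R : realType) (k : nat) (k_gt0 : (0 < k)%N)
    (k_even : ~~ odd k) (G0 H G : hypergraph) (u : vertex G0) (w : vertex H)
    (defG : G = coalescence u w) (G_unif : uniform k G)
    (G_conn : connected_hypergraph G) (G_nob : ~ odd_bipartite G)
    (H_ob : odd_bipartite H) :
  exists2 lam : R, is_lambda_min k G lam & lam <= (deg u)%:R / (nu H)%:R.
Proof.
subst G; case: H_ob => V1 bip.
have nuG : (0 < nu (coalescence u w))%N by apply/card_gt0P; exists (inl u).
have nuH : (0 < nu H)%N by apply/card_gt0P; exists w.
have [lam [x xN0 [x_eq x_min]]] := @rayleigh_minimizer R k _ k_gt0 k_even G_unif nuG.
exists lam.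
  split; last by move=> mu; exact: H_eigenvalue_ge.
  by exists x => // i; exact: minimizer_H_eigenvector.
(* The minimum inequality is evaluated at the test vector, whose power sum is the denominator. *)
rewrite ler_pdivlMr ?ltr0n // -(@power_sum_test R k _ _ u w V1) //.
apply: le_trans (x_min _) _; apply: laplacian_form_test => //.
  exact: uniform_coal_inl G_unif.
exact: uniform_coal_inr G_unif.
Qed.
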